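(* Let $b\ge2$. For any $n\ge1$ and $i\in I$, $K_i(n)$ has a unique representation $$K_i(n)=\alpha_1\mathcal{B}(n_1)+\alpha_2\mathcal{B}(n_2)+\dots+\alpha_t\mathcal{B}(n_t)+K_\beta(1)$$ for some $t\ge0$, where: the $\alpha_j$ are integers in $[1,b-1]$ if $b$ is even, or in $[1,\frac{b-1}{2}]$ if $b$ is odd; $\beta\in I$; and if $t>0$ then $n_1>n_2>\dots>n_t$ with $n_j\in\{\lfloor n_{j-1}/2\rfloor,\lceil n_{j-1}/2\rceil\}$ for $j=2,\dots,t$ and $n_t\in\{2,3\}$.
   Context: Fix a base $b\ge2$. For $v\in\mathbb{N}$, $s(v)$ is the sum of the base-$b$ digits of $v$, $f(v)=v+s(v)$, and $F(u)=|\{v\in\mathbb{N}: f(v)=u\}|$. $K(n)$ is the smallest $u\in\mathbb{N}$ with $F(u)=n$, and for $n\ge2$, $B(n)=\lfloor\log_b K(n)\rfloor$ and $\mathcal{B}(n)=b^{B(n)}+1$. The index set $I$ is the set of residue classes modulo $b-1$ if $b$ is even, and the set of even residue classes $\{0,2,\dots,b-3\}$ modulo $b-1$ if $b$ is odd. For $i\in I$, $K_i(n)$ is the smallest $u\in\mathbb{N}$ with $F(u)=n$ and $u\equiv i\pmod{b-1}$. *)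

(* Defs.v *)
From mathcomp Require Import all_boot.
From mathcomp Require Import boolp.

Set Implicit Arguments.
Unset Strict Implicit.
Unset Printing Implicit Defensive.

(* The natural numbers include 0; the base [b] is assumed to satisfy [1 < b]
   wherever these definitions are used. *)

Definition digit_sum (b v : nat) : nat :=
  \sum_(k < (trunc_log b v).+1) (v %/ b ^ k) %% b.

Definition f (b v : nat) : nat := v + digit_sum b v.

(* Since [v <= f b v], every [v] with [f b v = u] lies in ['I_u.+1]. *)
Definition F (b u : nat) : nat := #|[set v : 'I_u.+1 | f b v == u]|.

(* Least natural number satisfying [P], with junk value 0 if there is none. *)
Definition least (P : pred nat) : nat :=
  if pselect (exists u, P u) is left exP then ex_minn exP else 0.

Definition K (b n : nat) : nat := least [pred u | F b u == n].

(* A residue class modulo [b - 1] is given by its representative in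
   [0, b - 2]. *)
Definition index_set (b : nat) : pred nat :=
  [pred i | (i < b.-1) && (odd b ==> ~~ odd i)].

Definition K_res_pred (b i n : nat) : pred nat :=
  [pred u | (F b u == n) && (u == i %[mod b.-1])].

Definition K_res (b i n : nat) : nat := least (K_res_pred b i n).

Definition B (b n : nat) : nat := trunc_log b (K b n).

Definition calB (b n : nat) : nat := b ^ B b n + 1.

Definition max_coef (b : nat) : nat := if odd b then b.-1./2 else b.-1.

(* [s] lists the pairs (alpha_1, n_1), ..., (alpha_t, n_t), with t = size s. *)
Definition is_representation (b u : nat) (s : seq (nat * nat)) (beta : nat)
    : Prop :=
  [/\ u = (\sum_(p <- s) p.1 * calB b p.2) + K_res b beta 1,
      {in s, forall p, 1 <= p.1 <= max_coef b},
      beta \in index_set b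
    & s != [::] ->
      let ns := [seq p.2 | p <- s] in
      [/\ sorted (fun m m' => m > m') ns,
          sorted (fun m m' => (m' == m./2) || (m' == uphalf m)) ns
        & last 0 ns \in [:: 2; 3]]].

(* Main.v *)
Require Import Defs.
From mathcomp Require Import all_boot.
From mathcomp Require Import boolp zify.

(* Removing the leading digit of a generator, and complementing the remaining
   [k] digits in one of the two possible cases, gives the recurrence
     [F (d * (b ^ k + 1) + r) = F r + F ((b - 1) * k - 2 - r)].
   Hence for [n > 1] the numbers with [n] generators have exponent at least the
   least [k] such that [r + r' + 2 = (b - 1) * k] for some [r, r'] with
   [F r, F r' > 0] and [F r + F r' = n]; since [d] shifts the residue by [2 * d],
   every admissible residue class is reached at this [k], which is [B n].
   Minimality of [k] forces [r] to be the least number in its class with [F r]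
   generators, and the growth of [B] forces [F r] and [F r'] to differ by at
   most 1; this yields the representation by iteration. Uniqueness is that of a
   greedy expansion, as [(max_coef + 1) * calB n <= calB (n + 1)]. *)

Set Implicit Arguments.
Unset Strict Implicit.
Unset Printing Implicit Defensive.

Lemma sum_blocks (G : nat -> nat) n m :
  \sum_(0 <= v < n * m) G v = \sum_(0 <= d < n) \sum_(0 <= w < m) G (d * m + w).
Proof.
elim: n => [|n IH]; first by rewrite mul0n !big_geq.
rewrite big_nat_recr //= -IH mulSn addnC.
rewrite (big_cat_nat (leq0n (n * m))) ?leq_addr //=; congr (_ + _).
rewrite -{1}[n * m]add0n big_addn addKn; apply: eq_bigr => i _.
by rewrite addnC.
Qed.

Lemma leastP (P : pred nat) : (exists u, P u) ->
  P (least P) /\ forall v, P v -> least P <= v.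
Proof.
by rewrite /least => hP; case: pselect => // exP; case: ex_minnP.
Qed.

Lemma modn_lt_gap x y m : x = y %[mod m] -> x < y -> x + m <= y.
Proof.
move=> e xy; have : m %| y - x by rewrite -(eqn_mod_dvd _ (ltnW xy)) e.
by move=> /dvdn_leq; rewrite subn_gt0 xy => /(_ isT); lia.
Qed.

(** * Digit sums and the recurrence for [F] *)

Section Digits.

Variables (b : nat) (hb : 1 < b).

Lemma expb_gt0 k : 0 < b ^ k.
Proof. by rewrite expn_gt0 ltnW. Qed.

Lemma digit_sumE v N : v < b ^ N ->
  digit_sum b v = \sum_(k < N) (v %/ b ^ k) %% b.
Proof.
move=> vN; rewrite /digit_sum.
have vT : v < b ^ (trunc_log b v).+1 by apply: trunc_log_ltn.
have widen (m n : nat) : v < b ^ m -> m <= n ->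
    \sum_(k < n) (v %/ b ^ k) %% b = \sum_(k < m) (v %/ b ^ k) %% b.
  move=> vm mn; rewrite -!(big_mkord xpredT (fun k => (v %/ b ^ k) %% b)).
  rewrite (big_cat_nat (leq0n m) mn) /= [X in _ + X]big_nat_cond.
  rewrite [X in _ + X]big1 ?addn0 // => k /andP[/andP[mk _] _].
  by rewrite divn_small ?mod0n // (leq_trans vm) // leq_pexp2l // ltnW.
by case: (leqP N (trunc_log b v).+1) => [/widen|/ltnW/widen] ->.
Qed.

Lemma digit_sum_top d w k : d < b -> w < b ^ k ->
  digit_sum b (d * b ^ k + w) = d + digit_sum b w.
Proof.
move=> db wk; rewrite (digit_sumE wk) (@digit_sumE _ k.+1); last first.
  by rewrite expnS (@leq_trans (d.+1 * b ^ k)) ?leq_mul2r ?db ?orbT //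
    mulSn addnC ltn_add2r.
rewrite big_ord_recr /= divnMDl ?expb_gt0 // divn_small // addn0 modn_small //.
rewrite addnC; congr (_ + _); apply: eq_bigr => -[i ik] _ /=.
have -> : d * b ^ k = d * b ^ (k - i.+1) * b * b ^ i.
  by rewrite -!mulnA -expnS -expnD subnK.
by rewrite divnMDl ?expb_gt0 // modnMDl.
Qed.

Lemma f_top d w k : d < b -> w < b ^ k ->
  f b (d * b ^ k + w) = d * (b ^ k + 1) + f b w.
Proof. by move=> db wk; rewrite /f digit_sum_top //; lia. Qed.

Lemma top_digitP w k : w < b ^ k.+1 ->
  exists d w0, [/\ d < b, w0 < b ^ k & w = d * b ^ k + w0].
Proof.
rewrite expnS => wk; exists (w %/ b ^ k), (w %% b ^ k).
by rewrite ltn_divLR ?expb_gt0 // ltn_pmod ?expb_gt0 // -divn_eq.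
Qed.

Lemma digit_sum0 : digit_sum b 0 = 0.
Proof. by rewrite (@digit_sumE 0 0) // big_ord0. Qed.

(** The digits of [(b ^ k).-1 - w] are the complements to [b.-1] of the [k] padded digits of [w]. *)
Lemma digit_sum_compl w k : w < b ^ k ->
  digit_sum b w + digit_sum b ((b ^ k).-1 - w) = b.-1 * k.
Proof.
elim: k w => [|k IH] w; first by case: w; rewrite // digit_sum0 muln0.
move=> /top_digitP[d [w0 [db w0k ->]]].
have := expb_gt0 k => bk.
have -> : (b ^ k.+1).-1 - (d * b ^ k + w0) = (b.-1 - d) * b ^ k + ((b ^ k).-1 - w0).
  rewrite expnS; nia.
rewrite !digit_sum_top //; try lia.
have := IH _ w0k; lia.
Qed.

Lemma f_compl w k : w < b ^ k ->
  f b w + f b ((b ^ k).-1 - w) = (b ^ k).-1 + b.-1 * k.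
Proof. by move=> wk; rewrite -(digit_sum_compl wk) /f; lia. Qed.

(** Each leading digit [d] contributes [d * (b ^ k + 1)], even for odd [b]; this is why only even
    classes are indexed then. *)
Lemma odd_f v : odd b -> ~~ odd (f b v).
Proof.
move=> ob; have: v < b ^ v by apply: ltn_expl.
move: {2}v => k; elim: k v => [|k IH] v; first by case: v => //; rewrite /f digit_sum0.
move=> /top_digitP[d [w [db wk ->]]].
by rewrite f_top // oddD oddM oddD oddX ob orbT andbF /= IH.
Qed.

Lemma leq_f v : v <= f b v.
Proof. exact: leq_addr. Qed.

Lemma F_sum u N : (forall v, N <= v -> f b v != u) ->
  F b u = \sum_(0 <= v < N) (f b v == u).
Proof.
move=> hN.
have -> : F b u = \sum_(0 <= v < u.+1) (f b v == u).
  by rewrite /F -sum1dep_card big_mkcond /= big_mkord; apply: eq_bigr => i _; case: ifP.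
have widen m n : (forall v, m <= v -> f b v != u) -> m <= n ->
    \sum_(0 <= v < n) (f b v == u) = \sum_(0 <= v < m) (f b v == u).
  move=> hm mn; rewrite (big_cat_nat (leq0n m) mn) /= [X in _ + X]big_nat_cond.
  rewrite [X in _ + X]big1 ?addn0 // => k /andP[/andP[mk _] _].
  by rewrite (negbTE (hm _ mk)).
have hu v : u < v -> f b v != u.
  by move=> uv; rewrite gtn_eqF // (leq_trans uv) // leq_f.
by case: (leqP N u.+1) => [/widen|/ltnW/widen] ->.
Qed.

Lemma F_gt0 u : 0 < F b u -> exists v, f b v = u.
Proof. by move=> /card_gt0P[v]; rewrite inE => /eqP <-; exists v. Qed.

Lemma F_odd u : odd b -> 0 < F b u -> ~~ odd u.
Proof. by move=> ob /F_gt0[v <-]; apply: odd_f. Qed.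

Lemma leq_expb k : b.-1 * k < b ^ k.
Proof. by elim: k => [|k IH]; rewrite ?muln0 // expnS; nia. Qed.

Lemma F_block x k : x <= b ^ k ->
  \sum_(0 <= w < b ^ k) (f b w == x) = F b x.
Proof.
move=> xk; rewrite (@F_sum _ (b ^ k)) // => v; rewrite leq_eqVlt => /orP[/eqP<-|kv].
  (* The boundary case [v = b ^ k] has [f b v = b ^ k + 1], so [x = b ^ k] is still allowed. *)
  rewrite -[b ^ k]addn0 -[b ^ k]mul1n f_top ?expb_gt0 //; lia.
have := leq_f v; lia.
Qed.

(** By [f_compl], the reflection of [w] to [(b ^ k).-1 - w] turns the value [x + (b ^ k + 1)] into
    [b.-1 * k - 2 - x]. *)
Lemma F_block_compl x k :
  \sum_(0 <= w < b ^ k) (f b w == x + (b ^ k + 1)) =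
  if x + 2 <= b.-1 * k then F b (b.-1 * k - 2 - x) else 0.
Proof.
have bk := expb_gt0 k; have hk := leq_expb k.
case: ifP => hx.
  rewrite -(@F_block _ k); last lia.
  rewrite big_nat_rev /=.
  rewrite !big_nat; apply: eq_bigr => w /andP[_ wk].
  have -> : 0 + b ^ k - w.+1 = (b ^ k).-1 - w by lia.
  have := f_compl wk.
  by do 2 case: eqP; lia.
rewrite big_nat big1 // => w /andP[_ wk].
by have := f_compl wk; case: eqP; lia.
Qed.

(** Sort the generators by their leading digit [e]. For [e = d] the rest must map to [r], for
    [e = d.-1] to [r + (b ^ k + 1)]. Smaller [e] fall short since [b.-1 * k < b ^ k], and larger
    ones overshoot since [r <= b ^ k]. *)
Lemma F_rec d k r : 0 < d < b -> r <= b ^ k -> d * (b ^ k + 1) + r <= b ^ k.+1 ->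
  F b (d * (b ^ k + 1) + r) =
  F b r + if r + 2 <= b.-1 * k then F b (b.-1 * k - 2 - r) else 0.
Proof.
move=> /andP[d0 db] rk uk; have bk := expb_gt0 k; have hk := leq_expb k.
rewrite -(F_block uk) expnS sum_blocks.
rewrite (eq_big_nat _ _ (F2 := fun e =>
   \sum_(0 <= w < b ^ k) (e * (b ^ k + 1) + f b w == d * (b ^ k + 1) + r))); last first.
  move=> e /andP[_ eb]; rewrite !big_nat; apply: eq_bigr => w /andP[_ wk].
  by rewrite f_top.
rewrite (big_cat_nat (leq0n d.-1)) /=; last lia.
rewrite [X in X + _]big_nat [X in X + _]big1 ?add0n; last first.
  move=> e /andP[_ ed]; rewrite big_nat big1 // => w /andP[_ wk].
  have := f_compl wk; case: eqP => //; nia.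
rewrite (@big_ltn _ _ _ d.-1); last lia.
rewrite (@big_ltn _ _ _ d.-1.+1); last lia.
rewrite [X in _ + (_ + X) = _]big_nat [X in _ + (_ + X) = _]big1 ?addn0; last first.
  move=> e /andP[ed _]; rewrite big_nat big1 // => w /andP[_ wk].
  case: eqP => //; nia.
rewrite addnC prednK //; congr (_ + _).
  by rewrite -(F_block rk); apply: eq_bigr => w _; rewrite eqn_add2l.
rewrite -F_block_compl; apply: eq_bigr => w _.
rewrite -{2}(prednK d0) mulSn.
by rewrite -(eqn_add2l (d.-1 * (b ^ k + 1))); do 2 case: eqP; lia.
Qed.

Lemma decompP u : 1 < u -> exists k d r,
  [/\ 0 < d < b, r <= b ^ k, u = d * (b ^ k + 1) + r, b ^ k < u & u <= b ^ k.+1].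
Proof.
(* From here [u] is the predecessor: its logarithm gives an interval open on the left and closed on
   the right. *)
case: u => // u u0; set k := trunc_log b u.
have ku : b ^ k <= u by apply: trunc_logP.
have uk : u < b ^ k.+1 by apply: trunc_log_ltn.
exists k, (u.+1 %/ (b ^ k + 1)), (u.+1 %% (b ^ k + 1)).
split=> //; last exact: divn_eq.
  rewrite divn_gt0 ?ltn_divLR ?addn1 // ltnS ku mulnS -expnS.
  by rewrite -ltnS in uk; apply: leq_trans uk _; rewrite -add1n leq_add2r ltnW.
by rewrite -ltnS -[X in _ < X]addn1 ltn_pmod ?addn1.
Qed.

End Digits.

(* A lower bound for [B b n.+1 - B b n], [n > 1], and for [B b 2]. *)
Definition gap (b : nat) : nat := if odd b then 1 else 2.

(* A pair [(r, r')] as below is what the recurrence [F_rec] produces at a number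
   [d * (b ^ k + 1) + r] with [n] generators, when both terms are positive. *)
Definition splits (b n k : nat) : Prop := exists r r',
  [/\ 0 < F b r, 0 < F b r', F b r + F b r' = n & r + r' + 2 = b.-1 * k].

Definition is_exponent (b n k : nat) : Prop :=
  splits b n k /\ forall k', splits b n k' -> k <= k'.

(** * Splittings, residue classes and the exponent of [K] *)

Section Exponent.

Variables (b : nat) (hb : 1 < b).

Lemma modn_top d k r : d * (b ^ k + 1) + r = 2 * d + r %[mod b.-1].
Proof.
have bk : b ^ k + 1 = 2 %[mod b.-1].
  rewrite -modnDml -modnXm -{1}(prednK (ltnW hb)) -[b.-1.+1]addn1.
  by rewrite modnDl modnXm exp1n modnDml.
by rewrite -modnDml -modnMmr bk modnMmr modnDml mulnC.
Qed.

(** Halve the representative [e] of [i - r] in [[1, b - 1]]. An odd [e] occurs only for even [b],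
    and then [e + b.-1] is halved instead. Excluding [e = 0] keeps [d] positive. *)
Lemma coef_exists r i : i \in index_set b -> (odd b -> ~~ odd r) ->
  exists2 d, 0 < d <= max_coef b & 2 * d + r = i %[mod b.-1].
Proof.
rewrite inE => /andP[ilt iodd] rodd; rewrite /max_coef.
have M0 : 0 < b.-1 by lia.
have rM := divn_eq r b.-1; have r0 := ltn_pmod r M0.
set q := r %/ b.-1 in rM; set t := r %% b.-1 in rM r0.
have tpar : odd b -> ~~ odd t.
  move=> ob; have := rodd ob; rewrite rM oddD oddM.
  have -> : odd b.-1 = false by lia.
  by rewrite andbF.
have [e [c [e0 eM et]]] : exists e c, [/\ 0 < e, e <= b.-1 & e + t = i + c * b.-1].
  case: (ltnP t i) => ti; [exists (i - t), 0|exists (i + b.-1 - t), 1]; split; lia.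
have opar : odd b -> ~~ odd e.
  move=> ob; have ot := tpar ob; have om : odd b.-1 = false by lia.
  have := congr1 odd et; rewrite !oddD oddM om andbF (negbTE ot) !addbF => ->.
  by move: iodd; rewrite ob.
have [d [h [dM ed]]] : exists d h, 0 < d <= (if odd b then b.-1./2 else b.-1) /\
    2 * d = e + h * b.-1.
  case: (boolP (odd e)) => oe.
    by exists ((e + b.-1)./2), 1; case: ifP; lia.
  by exists e./2, 0; case: ifP; lia.
exists d => //; rewrite ed rM.
have -> : e + h * b.-1 + (q * b.-1 + t) = (h + q + c) * b.-1 + i by lia.
by rewrite modnMDl.
Qed.

Lemma mod_index u : 0 < F b u -> u %% b.-1 \in index_set b.
Proof.
move=> Fu; rewrite inE ltn_pmod /=; last by lia.
apply/implyP => ob; have := F_odd hb ob Fu.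
rewrite {1}(divn_eq u b.-1) oddD oddM.
have -> : odd b.-1 = false by lia.
  by rewrite andbF.
Qed.

Lemma index_compl j : j \in index_set b ->
  exists2 j', j' \in index_set b & b.-1 %| j + j' + 2.
Proof.
rewrite inE => /andP[jM jodd]; case: (leqP (j + 2) b.-1) => hj.
  exists (b.-1 - 2 - j); last first.
    by have -> : j + (b.-1 - 2 - j) + 2 = b.-1 by lia.
  rewrite inE; apply/andP; split; first lia.
  by apply/implyP => ob; move: jodd; rewrite ob /=; lia.
exists j; first by rewrite inE jM.
have ->: j + j + 2 = b.-1 * 2 by lia.
exact: dvdn_mulr.
Qed.

Lemma F0 : F b 0 = 1.
Proof.
rewrite (@F_sum b 0 1) ?big_nat1 /f ?digit_sum0 // => v; lia.
Qed.

Lemma F_small_even u : u <= b -> ~~ odd u -> F b u = 1.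
Proof.
move=> ub /even_halfK; set d := u./2 => du.
case: (posnP d) => d0; first by rewrite -du d0 F0.
have := @F_rec b hb d 0 0; rewrite expn0 expn1 muln0 F0 !addn0 muln2 du.
by apply; lia.
Qed.

Lemma f_small v : v < b -> f b v = v.*2.
Proof.
move=> vb; have := @f_top b hb v 0 0 vb isT.
by rewrite expn0 muln1 addn0 muln2 {2}/f digit_sum0 // !addn0.
Qed.

Lemma F_small_odd u : ~~ odd b -> u < b -> odd u -> F b u = 0.
Proof.
move=> ob ub ou; apply/eqP; case: posnP => // /F_gt0[v fv].
have vb : v < b by apply: leq_ltn_trans ub; rewrite -fv leq_f.
by move: ou; rewrite -fv f_small // odd_double.
Qed.

Lemma one_generator i : i \in index_set b ->
  exists u, [/\ u = i %[mod b.-1], F b u = 1 & u + 2 <= gap b * b.-1].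
Proof.
rewrite inE => /andP[iM iodd]; rewrite /gap.
case: (boolP (odd i)) => oi; last first.
  exists i; split=> //; first by apply: F_small_even => //; lia.
  by case: ifP; lia.
have ob : ~~ odd b by move: iodd; rewrite oi /= implybF.
(* Here [i] and [b.-1] are odd, so the sum is even. Beyond [b], it is [(b + 1) + (i - 2)], where
   [F_rec] leaves one odd term with no generator and one even term with a single one. *)
exists (i + b.-1); rewrite modnDr (negbTE ob); split=> //; last lia.
case: (ltnP i 2) => i2; first by apply: F_small_even; lia.
have := @F_rec b hb 1 1 (i - 2); rewrite !expn1 mul1n !muln1.
have -> : b + 1 + (i - 2) = i + b.-1 by lia.
move=> -> //; [|lia|by rewrite expnS expn1; nia].
rewrite F_small_odd //; [|lia|lia].
have -> : i - 2 + 2 <= b.-1 by lia.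
by rewrite add0n F_small_even //; lia.
Qed.

Lemma splits_gap n k : splits b n k -> gap b <= k.
Proof.
move=> [r [r' [Fr Fr' _ e]]]; rewrite /gap; case: ifP => ob.
  by case: k e; lia.
(* For even [b], [k = 1] would make [r + r'] the odd number [b - 3]. *)
case: k e => [|[|//]]; first lia.
rewrite muln1 => e.
have : odd r || odd r' by lia.
by case/orP => o; [move: Fr|move: Fr']; rewrite F_small_odd ?ob //; lia.
Qed.

(** A summand of a splitting satisfies [r + 2 <= b.-1 * k], so this keeps [d * (b ^ k + 1) + r] in
    the range of [F_rec] for all [d <= max_coef b]. *)
Lemma top_bound k : gap b <= k ->
  max_coef b * (b ^ k + 1) + b.-1 * k <= b ^ k.+1 + 2.
Proof.
rewrite /gap /max_coef expnS; case: ifP => ob k1.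
  have := leq_expb hb k; set h := b.-1./2 => hk.
  have eb : b = h.*2.+1 by rewrite /h; lia.
  move: (b ^ k) hk => x; rewrite eb /=; nia.
suff : b.-1 * k.+1 <= b ^ k + 2 by move: (b ^ k); case: b hb => //; nia.
elim: k k1 => // k IH; rewrite leq_eqVlt => /orP[/eqP [<-]|/IH{}IH].
  by rewrite expnS expn1; nia.
have := expb_gt0 hb k; rewrite expnS; nia.
Qed.

(* The left-hand side bounds the sum of two numbers of exponent [k], the first of
   which has leading coefficient 1. *)
Lemma gap_bound k : gap b <= k ->
  (b ^ k + 1) + max_coef b * (b ^ k + 1) + 2 * (b.-1 * k) <= b ^ (k + gap b) + 4.
Proof.
rewrite /gap /max_coef; case: ifP => ob k1.
  set h := b.-1./2; have eb : b = h.*2.+1 by rewrite /h; lia.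
  have h0 : 0 < h by lia.
  suff : h + 1 + 4 * (h * k) <= h * b ^ k + 4.
    rewrite [k + 1]addn1 expnS; move: (b ^ k) => x; rewrite eb /=; nia.
  case: (leqP k 1) => k2.
    have -> : k = 1 by lia.
    rewrite expn1 eb; nia.
  suff : 4 * k + 1 <= b ^ k by nia.
  elim: k k2 {k1} => // k IH; rewrite leq_eqVlt => /orP[/eqP [<-]|k2].
    by rewrite expnS expn1; nia.
  have : 3 * b ^ k <= b * b ^ k by rewrite leq_mul2r; lia.
  by have := IH k2; rewrite expnS; lia.
have := leq_expb hb k; rewrite addn2 !expnS; move: (b ^ k) => x hk.
have hx : 0 < x by apply: leq_ltn_trans hk.
have : 2 * (b * x) <= b * (b * x) by rewrite leq_mul2r hb orbT.
have : b + 2 * x <= b * x + 2 by nia.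
have -> : b.-1 * (x + 1) = b * x + b - x - 1 by case: b hb => //=; lia.
lia.
Qed.

Lemma splits_top n k r r' d : 0 < F b r -> 0 < F b r' -> F b r + F b r' = n ->
  r + r' + 2 = b.-1 * k -> 0 < d <= max_coef b ->
  F b (d * (b ^ k + 1) + r) = n /\ d * (b ^ k + 1) + r <= b ^ k.+1.
Proof.
move=> Fr Fr' en e /andP[d0 dM].
have gk : gap b <= k by apply: (@splits_gap n); exists r, r'.
have ub : d * (b ^ k + 1) + r <= b ^ k.+1.
  have := top_bound gk.
  have : d * (b ^ k + 1) <= max_coef b * (b ^ k + 1) by rewrite leq_mul2r dM orbT.
  lia.
split=> //; rewrite F_rec //.
- have -> : r + 2 <= b.-1 * k by lia.
  by have -> : b.-1 * k - 2 - r = r' by lia.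
- by rewrite d0 (leq_ltn_trans dM) // /max_coef; case: ifP; lia.
- have := leq_expb hb k; lia.
Qed.

Lemma splits_residue n k r r' i : 0 < F b r -> 0 < F b r' -> F b r + F b r' = n ->
  r + r' + 2 = b.-1 * k -> i \in index_set b ->
  exists d, [/\ 0 < d <= max_coef b, d * (b ^ k + 1) + r = i %[mod b.-1],
   F b (d * (b ^ k + 1) + r) = n & d * (b ^ k + 1) + r <= b ^ k.+1].
Proof.
move=> Fr Fr' en e iI.
have [d dM di] := coef_exists iI (fun ob => F_odd hb ob Fr).
by exists d; have [] := splits_top Fr Fr' en e dM; split; rewrite ?modn_top.
Qed.

(** Strong induction on [u]: if one term of [F_rec] vanishes, the other is attained at a smaller
    number with [n] generators; otherwise the two terms form a splitting of [n]. *)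
Lemma exponent_lt n k u : 1 < n -> (forall k', splits b n k' -> k <= k') ->
  F b u = n -> b ^ k < u.
Proof.
move=> n2 kmin; elim/ltn_ind: u => u IH Fu.
have u1 : 1 < u.
  case: u Fu {IH} => [|[|//]]; first by rewrite F0; lia.
  case: (boolP (odd b)) => ob Fu; first by have := @F_odd b hb 1 ob; lia.
  by move: Fu; rewrite F_small_odd //; lia.
have [e [d [r [dM rb eu eu1 eu2]]]] := decompP hb u1.
have ru : r < u by rewrite eu; nia.
have hk := leq_expb hb e.
have := F_rec hb dM rb; rewrite -eu => /(_ eu2); rewrite Fu.
case: (posnP (F b r)) => Fr.
  rewrite Fr; case: ifP => // hr en; last by lia.
  have := IH (b.-1 * e - 2 - r); lia.
case: ifP => hr en; last by have := IH _ ru; lia.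
case: (posnP (F b (b.-1 * e - 2 - r))) => Fr'; first by have := IH _ ru; lia.
have ke : k <= e by apply: kmin; exists r, (b.-1 * e - 2 - r); split; lia.
by apply: leq_ltn_trans eu1; rewrite leq_exp2l.
Qed.

Lemma exponent_decomp n k u : 1 < n -> (forall k', splits b n k' -> k <= k') ->
  F b u = n -> u <= b ^ k.+1 -> exists d r r', [/\ 0 < d < b,
    u = d * (b ^ k + 1) + r, 0 < F b r /\ 0 < F b r', F b r + F b r' = n &
    r + r' + 2 = b.-1 * k].
Proof.
move=> n2 kmin Fu uk.
have ku := exponent_lt n2 kmin Fu.
have [|e [d [r [dM rb eu eu1 eu2]]]] := @decompP b hb u.
  have := expb_gt0 hb k; lia.
have ek : e = k.
  have : e < k.+1 by rewrite -(ltn_exp2l _ _ hb); lia.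
  have : k < e.+1 by rewrite -(ltn_exp2l _ _ hb); lia.
  lia.
subst e; have hk := leq_expb hb k.
have := F_rec hb dM rb; rewrite -eu => /(_ eu2); rewrite Fu.
(* A term equal to [n] would sit at a number at most [b ^ k], against [exponent_lt]; hence both
   terms are positive. *)
have Frn : F b r != n.
  by apply/eqP => /(exponent_lt n2 kmin); lia.
case: ifP => hr en; last by lia.
have Frn' : F b (b.-1 * k - 2 - r) != n.
  by apply/eqP => /(exponent_lt n2 kmin); lia.
exists d, r, (b.-1 * k - 2 - r); split=> //; lia.
Qed.

Lemma exponent_exists n k : splits b n k -> exists k, is_exponent b n k.
Proof.
move=> nk; have [] := @leastP (fun k => `[< splits b n k >]).
  by exists k; apply/asboolP.
by move=> /asboolP h1 h2; eexists; split; [exact: h1|move=> k' /asboolP/h2].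
Qed.

Lemma splits_of u u' j j' : 0 < F b u -> 0 < F b u' -> u = j %[mod b.-1] ->
  u' = j' %[mod b.-1] -> b.-1 %| j + j' + 2 ->
  exists2 k, splits b (F b u + F b u') k & u + u' + 2 = b.-1 * k.
Proof.
move=> Fu Fu' uj uj' dv.
have : b.-1 %| u + u' + 2.
  move: dv; rewrite /dvdn -[(u + u' + 2) %% _]modnDml -[(u + u') %% _]modnDm uj uj'.
  by rewrite modnDm modnDml.
by move=> /dvdnP[k e]; exists k; [exists u, u'; split=> //|]; rewrite e mulnC.
Qed.

(** Pair a number with [n] generators and a one-generator number of the complementary class; a
    leading coefficient then restores the class [i]. *)
Lemma generator_exists n : 0 < n -> forall i, i \in index_set b ->
  exists u, K_res_pred b i n u.
Proof.
elim: n => // -[|n] IH _ i iI.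
  by have [u [ui Fu _]] := one_generator iI; exists u; apply/andP; split; apply/eqP.
have [u /andP[/= /eqP Fu /eqP ui]] := IH isT i iI.
have [j jI dv] := index_compl iI.
have [u' [uj Fu' _]] := one_generator jI.
have [||k [r [r' [Fr Fr' en e]]] _] := splits_of _ _ ui uj dv; rewrite ?Fu ?Fu' //.
have [d [_ di Fd _]] := splits_residue Fr Fr' en e iI.
exists (d * (b ^ k + 1) + r); apply/andP; split; apply/eqP => //.
by rewrite Fd Fu Fu' addn1.
Qed.

Lemma has_exponent n : 1 < n -> exists k, is_exponent b n k.
Proof.
case: n => // n n1.
have iI : 0 \in index_set b by rewrite inE implybT andbT; lia.
have [u /andP[/= /eqP Fu /eqP ui]] := generator_exists n1 iI.
have [j jI dv] := index_compl iI.
have [u' [uj Fu' _]] := one_generator jI.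
have [||k sk _] := splits_of _ _ ui uj dv; rewrite ?Fu ?Fu' //.
by apply: (@exponent_exists _ k); rewrite Fu Fu' addn1 in sk.
Qed.

(** Leading coefficient 1 gives a number with [n] generators below [b ^ k.+1]; [exponent_lt] is the
    matching lower bound. *)
Lemma B_exponent n k : 1 < n -> is_exponent b n k -> B b n = k.
Proof.
move=> n2 [[r [r' [Fr Fr' en e]]] kmin].
have hk := leq_expb hb k; have bk := expb_gt0 hb k.
have [] := @splits_top n k r r' 1 Fr Fr' en e.
  by rewrite /max_coef; case: ifP; lia.
rewrite mul1n => Fd _.
have [|/eqP FK Kmin] := @leastP [pred u | F b u == n].
  by exists (b ^ k + 1 + r); apply/eqP.
have := exponent_lt n2 kmin FK; rewrite -/(K b n) => kK.
have Kk : K b n <= b ^ k + 1 + r by apply: Kmin; apply/eqP.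
apply: trunc_log_eq => //; rewrite expnS; apply/andP; split; first exact: ltnW.
have : 2 * b ^ k <= b * b ^ k by rewrite leq_mul2r hb orbT.
lia.
Qed.

End Exponent.

(** * Growth and balance of exponents *)

Section Growth.

Variables (b : nat) (hb : 1 < b).

(** The induction invariant for growth: as [r + r' + 2 = b.-1 * k], lowering [r] by [gap b * b.-1]
    lowers [k] by [gap b]. *)
Definition drops p := forall u, F b u = p -> exists u',
  [/\ u' = u %[mod b.-1], F b u' = p.-1 & u' + gap b * b.-1 <= u].

Lemma splits_drop p k r r' : drops (F b r) -> 1 < F b r -> 0 < F b r' ->
  F b r + F b r' = p -> r + r' + 2 = b.-1 * k ->
  exists2 k', splits b p.-1 k' & k' + gap b <= k.
Proof.
move=> dr Fr Fr' ep e; have [u [ur Fu ule]] := dr _ erefl.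
have dv : b.-1 %| r + r' + 2 by rewrite e dvdn_mulr.
have [|//|k' sk ek] := splits_of _ _ ur erefl dv; first by rewrite Fu; lia.
exists k'; first by rewrite -ep -subn1 -addnBAC ?subn1 -?Fu //; lia.
have M0 : 0 < b.-1 by lia.
rewrite -(leq_pmul2l M0) mulnDr -ek -e; lia.
Qed.

Lemma exponent_step p k k1 : (forall q, 1 < q <= p -> drops q) -> 1 < p ->
  is_exponent b p k -> is_exponent b p.+1 k1 -> k + gap b <= k1.
Proof.
move=> dr p2 [_ kmin] [[r [r' [Fr Fr' ep e]]] _].
case: (ltnP 1 (F b r)) => Fr1.
  have dr1 : drops (F b r) by apply: dr; lia.
  by have [k' /kmin] := splits_drop dr1 Fr1 Fr' ep e; lia.
have Fr2 : 1 < F b r' by lia.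
have dr2 : drops (F b r') by apply: dr; lia.
rewrite addnC in ep; rewrite [r + r']addnC in e.
by have [k' /kmin] := splits_drop dr2 Fr2 Fr ep e; lia.
Qed.

Lemma dropsP p : 1 < p -> drops p.
Proof.
elim/ltn_ind: p => -[|[|[|p]]] // IH _ u Fu.
  have [k ek] := has_exponent hb (n := 2) isT.
  have uk := exponent_lt hb (n := 2) isT ek.2 Fu.
  have gk := splits_gap hb ek.1.
  have ug : b ^ gap b < u by apply: leq_ltn_trans uk; rewrite leq_exp2l.
  have [|u' [uu' Fu' ule]] := @one_generator b hb (u %% b.-1).
    by apply: mod_index => //; rewrite Fu.
  rewrite modn_mod in uu'; exists u'; split=> //.
  move: ug ule; rewrite /gap; case: ifP => ob; last by rewrite expnS expn1; nia.
  rewrite expn1 !mul1n => ug ule; apply: modn_lt_gap => //; lia.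
have [k ek] := has_exponent hb (n := p.+2) isT.
have [k1 ek1] := has_exponent hb (n := p.+3) isT.
have kk1 : k + gap b <= k1.
  by apply: exponent_step ek ek1 => // q /andP[q1 q2]; apply: IH.
have uk := exponent_lt hb (n := p.+3) isT ek1.2 Fu.
have ug : b ^ (k + gap b) < u by apply: leq_ltn_trans uk; rewrite leq_exp2l.
have uI : u %% b.-1 \in index_set b by apply: mod_index; rewrite ?Fu.
have [[r [r' [Fr Fr' ep e]]] _] := ek.
have [d [_ du Fd dle]] := splits_residue hb Fr Fr' ep e uI.
rewrite modn_mod in du; eexists; split; [exact: du|exact: Fd|].
(* For even [b], [b ^ k.+2 - b ^ k.+1 = b.-1 * b ^ k.+1] exceeds the required drop; for odd [b],
   congruent numbers on either side of [b ^ k.+1] already differ by [b.-1]. *)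
move: ug; rewrite /gap; case: ifP => ob; last first.
  rewrite addn2 [b ^ k.+2]expnS.
  have : b <= b ^ k.+1 by rewrite expnS leq_pmulr // expb_gt0.
  move: (b ^ k.+1) dle => y dle byy.
  have : b * y = y + b.-1 * y by rewrite -mulSn prednK // ltnW.
  have : b.-1 * 2 <= b.-1 * y by rewrite leq_mul2l (leq_trans hb byy) orbT.
  by rewrite mulnC; lia.
rewrite addn1 mul1n => ug; apply: modn_lt_gap => //; lia.
Qed.

Lemma exponent_ltS n k k1 : 1 < n -> is_exponent b n k ->
  is_exponent b n.+1 k1 -> k + gap b <= k1.
Proof.
by move=> n2; apply: exponent_step => // q /andP[q1 _]; apply: dropsP.
Qed.

Lemma exponent_mono m n k k1 : 1 < m <= n -> is_exponent b m k ->
  is_exponent b n k1 -> k <= k1.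
Proof.
move=> /andP[m2]; elim: n k1 => [|n IH] k1; first by lia.
rewrite leq_eqVlt => /orP[/eqP <-|mn ek ek1].
  by move=> [_ kmin] [s1 _]; apply: kmin.
have [k2 ek2] := has_exponent hb (n := n) (leq_trans m2 mn).
have := exponent_ltS (leq_trans m2 mn) ek2 ek1.
have := IH _ mn ek ek2; lia.
Qed.

(* Otherwise, moving one generator from [r] to [r'] would make the sum smaller,
   as [F b r] forces [r] to exceed the two new summands together. *)
Lemma exponent_balanced n k r r' : (forall k', splits b n k' -> k <= k') ->
  0 < F b r' -> F b r + F b r' = n ->
  r + r' + 2 = b.-1 * k -> F b r <= F b r' + 1.
Proof.
move=> kmin Fr' en e; rewrite leqNgt; apply/negP => lt.
case em : (F b r) => [|m]; first by lia.
have m2 : 1 < m by lia.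
have [km ekm] := has_exponent hb m2.
have [kq ekq] := has_exponent hb (n := (F b r').+1) Fr'.
have [km1 ekm1] := has_exponent hb (n := m.+1) (ltnW m2).
have kqm : kq <= km by apply: exponent_mono ekq ekm; lia.
have kmm1 := exponent_ltS m2 ekm ekm1.
have ru := exponent_lt hb (ltnW m2 : 1 < m.+1) ekm1.2 em.
have rg : b ^ (km + gap b) < r by apply: leq_ltn_trans ru; rewrite leq_exp2l.
have gm := splits_gap hb ekm.1.
have [[x [x' [Fx Fx' ex e1]]] _] := ekm.
have [[y [y' [Fy Fy' ey e2]]] _] := ekq.
(* Coefficient 1 keeps [u] small and leaves its class uncontrolled; [u'] is then chosen in the
   complementary class. *)
have [|Fu ule] := splits_top hb Fx Fx' ex e1 (d := 1).
  by rewrite /max_coef; case: ifP; lia.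
set u := 1 * _ + _ in Fu ule.
have uI : u %% b.-1 \in index_set b by apply: mod_index => //; rewrite Fu; lia.
have [j jI dv] := index_compl hb uI.
have [d [/andP[_ dM] dj Fd _]] := splits_residue hb Fy Fy' ey e2 jI.
set u' := d * _ + _ in dj Fd.
have Fu0 : 0 < F b u by rewrite Fu; lia.
have Fd0 : 0 < F b u' by rewrite Fd.
have [k' sk ek] := splits_of Fu0 Fd0 (esym (modn_mod u b.-1)) dj dv.
rewrite Fu Fd in sk.
have kk' : k <= k' by apply: kmin; rewrite -en em addSnnS.
have hr : r + r' + 2 <= u + u' + 2 by rewrite e ek leq_mul2l kk' orbT.
have hu : u + 2 <= b ^ km + 1 + b.-1 * km.
  by rewrite /u mul1n -addnA leq_add2l -e1 leq_add2r leq_addr.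
have hu' : u' + 2 <= max_coef b * (b ^ km + 1) + b.-1 * km.
  rewrite /u' -addnA leq_add ?leq_mul ?leq_add2r ?leq_exp2l //.
  by apply: leq_trans (_ : b.-1 * kq <= _); rewrite ?leq_mul // -e2 leq_add2r leq_addr.
have hg := gap_bound hb gm; clearbody u u'; clear - hr hu hu' hg rg; lia.
Qed.

(** * The recurrence for [K_res] *)

Lemma K_resP n i : 0 < n -> i \in index_set b ->
  [/\ F b (K_res b i n) = n, K_res b i n = i %[mod b.-1] &
   forall v, F b v = n -> v = i %[mod b.-1] -> K_res b i n <= v].
Proof.
move=> n0 iI; have [/andP[/eqP FK /eqP Ki] Kmin] := leastP (generator_exists hb n0 iI).
by split=> // v Fv vi; apply: Kmin; apply/andP; split; apply/eqP.
Qed.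

Lemma K_res_rec n i : 1 < n -> i \in index_set b -> exists d m j,
  [/\ K_res b i n = d * calB b n + K_res b j m, 0 < d <= max_coef b,
      j \in index_set b & (m == n./2) || (m == uphalf n)].
Proof.
move=> n2 iI; have [k ek] := has_exponent hb n2.
have [FK Ki Kmin] := K_resP (ltnW n2) iI.
have Kk : K_res b i n <= b ^ k.+1.
  have [[x [x' [Fx Fx' ex e1]]] _] := ek.
  have [d [_ di Fd dle]] := splits_residue hb Fx Fx' ex e1 iI.
  by apply: leq_trans dle; apply: Kmin.
have [d [r [r' [dM eK [Fr Fr'] en e]]]] := exponent_decomp hb n2 ek.2 FK Kk.
have [d' [dM' di' Fd' _]] := splits_residue hb Fr Fr' en e iI.
(* [exponent_decomp] only gives [d < b]; minimality of [K_res] against [d'], used with the same [r],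
   bounds [d] by [max_coef b]. *)
have dd' : d <= d'.
  have := Kmin _ Fd' di'; rewrite {1}eK leq_add2r leq_mul2r; lia.
have rI := mod_index hb Fr.
have [FKr Kr Krmin] := K_resP Fr rI; rewrite modn_mod in Kr.
(* Replacing [r] by the least number of its class with equally many generators splits [n] again, so
   minimality of [k] forbids a smaller sum. *)
have er : K_res b (r %% b.-1) (F b r) = r.
  apply/eqP; rewrite eqn_leq Krmin ?modn_mod //=.
  have dv : b.-1 %| r + r' + 2 by rewrite e dvdn_mulr.
  have FK0 : 0 < F b (K_res b (r %% b.-1) (F b r)) by rewrite FKr.
  have [k' sk ek'] := splits_of FK0 Fr' Kr erefl dv.
  rewrite FKr en in sk; have := leq_mul (leqnn b.-1) (ek.2 _ sk).
  rewrite -e -ek'; lia.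
exists d, (F b r), (r %% b.-1); split=> //.
- by rewrite er /calB (B_exponent hb n2 ek).
- by case/andP: dM dM' => -> _ /andP[_]; apply: leq_trans.
have h := exponent_balanced ek.2 Fr' en e.
have h' : F b r' <= F b r + 1.
  by apply: exponent_balanced ek.2 Fr _ _; [rewrite addnC|rewrite [r' + r]addnC].
by clear - h h' en; lia.
Qed.

(** * Greedy expansions and representations *)

Lemma K_res1_lt n i : 1 < n -> i \in index_set b -> K_res b i 1 < calB b n.
Proof.
move=> n2 iI; have [k ek] := has_exponent hb n2.
rewrite /calB (B_exponent hb n2 ek).
have [_ _ Kmin] := K_resP (n := 1) isT iI.
have [u [ui Fu ule]] := one_generator hb iI.
have := Kmin _ Fu ui.
have : b ^ gap b <= b ^ k by rewrite leq_exp2l // (splits_gap hb ek.1).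
move: ule; rewrite /gap; case: ifP => ob; rewrite ?expnS ?expn1 ?expn0; nia.
Qed.

Lemma calB_step n : 1 < n -> (max_coef b).+1 * calB b n <= calB b n.+1.
Proof.
move=> n2; have [k ek] := has_exponent hb n2.
have [k1 ek1] := has_exponent hb (n := n.+1) (ltnW n2).
have := exponent_ltS n2 ek ek1.
rewrite /calB (B_exponent hb n2 ek) (B_exponent hb (ltnW n2 : 1 < n.+1) ek1) => kk1.
have : b ^ (k + gap b) <= b ^ k1 by rewrite leq_exp2l.
have bk := expb_gt0 hb k.
have := gap_bound hb (splits_gap hb ek.1).
(* [e] gives [b.-1 * k >= 2], which absorbs the 4 in [gap_bound]. *)
have [[x [x' [_ _ _ e]]] _] := ek.
rewrite mulSn; lia.
Qed.

Lemma calB_mono m n : 1 < m -> m < n -> (max_coef b).+1 * calB b m <= calB b n.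
Proof.
move=> m2; elim: n => // n IH; rewrite ltnS leq_eqVlt => /orP[/eqP <-|mn].
  exact: calB_step.
apply: leq_trans (IH mn) _; apply: leq_trans (calB_step (ltn_trans m2 mn)).
exact: leq_pmull.
Qed.

Definition value (s : seq (nat * nat)) (beta : nat) : nat :=
  (\sum_(p <- s) p.1 * calB b p.2) + K_res b beta 1.

Definition admissible (s : seq (nat * nat)) : bool :=
  [&& all (fun p => 0 < p.1 <= max_coef b) s, all (fun p => 1 < p.2) s
    & sorted gtn [seq p.2 | p <- s]].

Lemma admissible_cons p s : admissible (p :: s) ->
  [/\ 0 < p.1 <= max_coef b, 1 < p.2, admissible s &
      all (fun q => q.2 < p.2) s].
Proof.
rewrite /admissible /= => /and3P[/andP[-> ->] /andP[-> ->] ps].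
rewrite (path_sorted ps); split=> //.
have /(order_path_min (rev_trans ltn_trans)) := ps.
by rewrite all_map.
Qed.

Lemma value_cons p s beta :
  value (p :: s) beta = p.1 * calB b p.2 + value s beta.
Proof. by rewrite /value big_cons addnA. Qed.

(** A tail stays below the next [calB], so the value is below [(max_coef b).+1 * calB b p.2] for the
    head [p], and [calB_mono] applies. *)
Lemma value_lt s beta n : admissible s -> beta \in index_set b -> 1 < n ->
  all (fun q => q.2 < n) s -> value s beta < calB b n.
Proof.
move=> + bI; elim: s n => [|p s IH] n.
  by rewrite /value big_nil add0n => _ n2 _; apply: K_res1_lt.
move=> /admissible_cons[/andP[p0 pM] p2 sad sp] n2 /= /andP[pn _].
rewrite value_cons; have := IH _ sad p2 sp.
have := calB_mono p2 pn; rewrite mulSn.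
have : p.1 * calB b p.2 <= max_coef b * calB b p.2 by rewrite leq_mul2r pM orbT.
lia.
Qed.

(** By [value_lt] the leading indices agree; division by [calB] then recovers the coefficient and
    the tail. The residue of the last term recovers [beta]. *)
Lemma value_inj s s' beta beta' : admissible s -> admissible s' ->
  beta \in index_set b -> beta' \in index_set b ->
  value s beta = value s' beta' -> (s, beta) = (s', beta').
Proof.
move=> + + bI bI'; elim: s s' => [|[a m] s IH] [|[a' m'] s'].
- move=> _ _; rewrite /value !big_nil !add0n => e; congr (_, _).
  have [_ + _] := K_resP (n := 1) isT bI; have [_ + _] := K_resP (n := 1) isT bI'.
  rewrite e => ->; move: bI bI'; rewrite !inE => /andP[b1 _] /andP[b2 _].
  by rewrite !modn_small.
- move=> _ /admissible_cons[/= /andP[p0 _] p2 _ _] e.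
  have := @value_lt [::] beta m' isT bI p2 isT; rewrite e value_cons /=; nia.
- move=> /admissible_cons[/= /andP[p0 _] p2 _ _] _ e.
  have := @value_lt [::] beta' m isT bI' p2 isT; rewrite -e value_cons /=; nia.
move=> ad ad'.
have [/= /andP[a0 _] m2 sad sm] := admissible_cons ad.
have [/= /andP[a0' _] m2' sad' sm'] := admissible_cons ad'.
move=> e; have lm : m' <= m.
  rewrite leqNgt; apply/negP => mm'.
  have := value_lt ad bI m2' => /=; rewrite mm' e value_cons /=.
  have -> : all (fun q => q.2 < m') s by apply: sub_all sm => q /= /ltn_trans; apply.
  by move=> /(_ isT); nia.
have lm' : m <= m'.
  rewrite leqNgt; apply/negP => mm'.
  have := value_lt ad' bI' m2 => /=; rewrite mm' -e value_cons /=.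
  have -> : all (fun q => q.2 < m) s' by apply: sub_all sm' => q /= /ltn_trans; apply.
  by move=> /(_ isT); nia.
have em : m = m' by apply/eqP; rewrite eqn_leq lm lm'.
subst m'; move: e; rewrite !value_cons /=.
have v1 := value_lt sad bI m2 sm; have v2 := value_lt sad' bI' m2 sm'.
have c0 : 0 < calB b m by rewrite /calB addn1.
move=> e; have ea : a = a'.
  have := congr1 (fun x => x %/ calB b m) e.
  by rewrite !divnMDl // !divn_small // !addn0.
subst a'; move/eqP: e; rewrite eqn_add2l => /eqP e.
by have [-> ->] := IH _ sad sad' e.
Qed.

Lemma representation_admissible u s beta :
  is_representation b u s beta -> admissible s.
Proof.
case=> _ sc _; case: s sc => // p s sc /(_ isT)[/= s1 _ s2].
apply/and3P; split=> //; first by apply/allP.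
elim: s p s1 s2 {sc} => [|q s IH] p /=; first by rewrite !inE; lia.
by move=> /andP[pq qs] /(IH _ qs) /= /andP[q2 ->]; rewrite q2 (ltn_trans q2 pq).
Qed.

(** The added clause on the head lets the induction check the halving condition when a new leading
    term is prepended. *)
Lemma representation_exists n i : 0 < n -> i \in index_set b ->
  exists s beta, is_representation b (K_res b i n) s beta /\
    if n == 1 then s = [::] else head 0 [seq p.2 | p <- s] = n.
Proof.
elim/ltn_ind: n i => n IH i n0 iI.
case: (ltngtP n 1) => [|n2|n1]; first by lia.
  have [d [m [j [eK dM jI em]]]] := K_res_rec n2 iI.
  have /andP[m0 mn] : 0 < m < n by clear - em n2; lia.
  have [s [beta [[es sc bI sh] hs]]] := IH m mn j m0 jI.
  exists ((d, n) :: s), beta; rewrite /=; split=> //; split=> //.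
  - by rewrite big_cons -addnA -es.
  - by move=> p; rewrite inE => /orP[/eqP ->//|/sc].
  move=> _; case: s hs sh {es sc} => [|p s] hs sh /=.
    (* An empty tail means [m = 1], whence [n] is 2 or 3. *)
    by split=> //; move: hs; case: ifP => /= [|_]; rewrite ?inE; lia.
  have [/= s1 s2 s3] := sh isT.
  have ep : p.2 = m by move: hs; case: ifP.
  by rewrite s1 s2 s3 ep em mn.
by exists [::], i; split=> //; split; rewrite // big_nil n1.
Qed.

End Growth.

Theorem theorem7p1 (b : nat) (hb : 2 <= b) (n i : nat) (hn : 1 <= n)
    (hi : i \in index_set b) :
  (exists u, K_res_pred b i n u) /\
  exists! r : seq (nat * nat) * nat,
    is_representation b (K_res b i n) r.1 r.2.
Proof.
(* This rules out the default value 0 of [least]. *)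
split; first exact: generator_exists.
have [s [beta [rep _]]] := representation_exists hb hn hi.
exists (s, beta); split=> //= -[s' beta'] /= rep'.
have ad := representation_admissible hb rep.
have ad' := representation_admissible hb rep'.
case: rep rep' => [e1 _ bI _] [e2 _ bI' _].
by apply: (value_inj hb ad ad' bI bI'); rewrite -[LHS]e1.
Qed.
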